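(* Let $\mathcal S\subset\mathbb R^n$ be nonempty, closed and convex, and let $Q_1,Q_2\in\mathbb R^{n\times n}$ be symmetric positive definite. Then for all $z_1,z_2\in\mathbb R^n$, $$\bigl\|P_{\mathcal S,Q_1}(z_1)-P_{\mathcal S,Q_2}(z_2)\bigr\|\le\sqrt{\frac{\lambda_{\max}(Q_1)}{\lambda_{\min}(Q_1)}}\;\|z_1-z_2\|+\frac{\|Q_1-Q_2\|}{\lambda_{\min}(Q_1)}\,\bigl\|P_{\mathcal S,Q_2}(z_2)-z_2\bigr\|.$$
   Context: $\|\cdot\|$ is the Euclidean norm on $\mathbb R^n$ and the Euclidean operator norm on matrices; $\lambda_{\min},\lambda_{\max}$ denote the smallest and largest eigenvalues of a symmetric matrix. For $Q$ symmetric positive definite, $\|x\|_Q:=\sqrt{x^\top Qx}$, and the metric projection is $P_{\mathcal S,Q}(y):=\operatorname{argmin}_{z\in\mathcal S}\tfrac12\|z-y\|_Q^2$, which exists and is unique. *)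

(* Defs.v *)
From HB Require Import structures.
From mathcomp Require Import all_boot all_order all_algebra.
From mathcomp Require Import all_classical all_reals all_analysis.

Set Implicit Arguments.
Unset Strict Implicit.
Unset Printing Implicit Defensive.

Import Order.TTheory GRing.Theory Num.Theory.
Import numFieldNormedType.Exports.

Local Open Scope classical_set_scope.
Local Open Scope ring_scope.

(* The library norm [`|x|] on matrices and vectors is the max norm, hence the
   Euclidean norms below.  Topological notions such as [closed] are the
   library's: on ['cV[R]_n] both norms induce the same topology. *)
Definition enorm (R : realType) (n : nat) (x : 'cV[R]_n) : R :=
  Num.sqrt (\sum_(i < n) x i ord0 ^+ 2).

(* Using the unit ball rather than the unit sphere keeps the set nonempty when
   n = 0. *)
Definition opnorm (R : realType) (m n : nat) (A : 'M[R]_(m, n)) : R :=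
  sup [set enorm (A *m x) | x in [set x : 'cV[R]_n | enorm x <= 1]].

(* A symmetric matrix of size n > 0 has finitely many, and at least one, real
   eigenvalues, so this [inf] and this [sup] are the smallest and the largest of
   them.  For n = 0 there is no eigenvalue and both are 0. *)
Definition lambda_min (R : realType) (n : nat) (A : 'M[R]_n) : R :=
  inf [set a : R | eigenvalue A a].

Definition lambda_max (R : realType) (n : nat) (A : 'M[R]_n) : R :=
  sup [set a : R | eigenvalue A a].

Definition sym_posdef (R : realType) (n : nat) (Q : 'M[R]_n) : Prop :=
  Q \is symmetricmx /\
  forall x : 'cV[R]_n, x != 0 -> 0 < (x^T *m Q *m x) ord0 ord0.

Definition qnorm (R : realType) (n : nat) (Q : 'M[R]_n) (x : 'cV[R]_n) : R :=
  Num.sqrt ((x^T *m Q *m x) ord0 ord0).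

Definition is_argmin (R : realType) (T : Type) (S : set T) (f : T -> R) (p : T)
    : Prop :=
  S p /\ forall z, S z -> f p <= f z.

(* [xget] picks a minimizer; its default value 0 is returned only when there is
   none, which does not occur for S nonempty, closed and convex and Q symmetric
   positive definite. *)
Definition metric_proj (R : realType) (n : nat) (S : set 'cV[R]_n)
    (Q : 'M[R]_n) (y : 'cV[R]_n) : 'cV[R]_n :=
  xget 0 [set p | is_argmin S (fun z => 2^-1 * qnorm Q (z - y) ^+ 2) p].

(* Main.v *)
(* Both projections satisfy the variational inequality of the minimum.  Adding
   the two and writing d, e, w for P1 - P2, P2 - z2, z1 - z2 gives
   |d|_Q1^2 <= <w, d>_Q1 + |Q1 - Q2| |e| |d|.  Cauchy-Schwarz for Q1 then yields
   a quadratic inequality in |d|_Q1, and the Rayleigh bounds compare |.|_Q1 with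
   the Euclidean norm.  The smallest eigenvalue is obtained as the minimum of
   the Rayleigh quotient on the compact unit sphere: A - m is positive
   semidefinite and isotropic at the minimizer c, hence kills c. *)
Require Import Defs.
From HB Require Import structures.
From mathcomp Require Import all_boot all_order all_algebra.
From mathcomp Require Import all_classical all_reals all_analysis.
From mathcomp Require Import ring lra.
Import Order.TTheory GRing.Theory Num.Theory.
Import numFieldNormedType.Exports.

Local Open Scope classical_set_scope.
Local Open Scope ring_scope.

Set Implicit Arguments.
Unset Strict Implicit.
Unset Printing Implicit Defensive.

(** * Compactness in the space of column vectors *)

(** A box of row vectors is compact as a product of segments, and transposition carries it to a
    compact set of columns that contains [K]. This serves both the Rayleigh quotient and the
    existence of projections. *)
Lemma closed_bounded_cV_min (R : realType) n (f : 'cV[R]_n -> R)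
    (K : set 'cV[R]_n) (M : R) :
  K !=set0 -> closed K -> (forall x, K x -> forall i, `|x i ord0| <= M) ->
  continuous f -> exists2 c, K c & forall x, K x -> f c <= f x.
Proof.
move=> K0 Kcl KM fc.
pose C := [set v : 'rV[R]_n | forall i, v ord0 i \in `[- M, M]].
have Cco : compact C.
  apply: (@rV_compact _ _ (fun=> `[- M, M]%classic)) => _.
  exact: segment_compact.
have trc : continuous (@trmx R 1 n).
  move=> v s /= /(nbhs_ballP v^T) [e e0 es].
  apply/nbhs_ballP; exists e => //= w [_ vw]; apply: es; split=> // i j.
  by rewrite !mxE; exact: vw.
have Kco : compact K.
  apply: (@subclosed_compact _ _ (@trmx R 1 n @` C)) => //.
    by apply: continuous_compact => //; exact: continuous_subspaceT.
  move=> x Kx; exists x^T; last by rewrite trmxK.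
  by move=> i; rewrite in_itv /= mxE -ler_norml KM.
have [c cK cmin] := compact_EVT_min K0 Kco (continuous_subspaceT fc).
by exists c => [|x Kx]; [exact: set_mem | exact/cmin/mem_set].
Qed.

(** * Bilinear forms and the Euclidean norm *)

Definition bform (R : realType) n (A : 'M[R]_n) (x y : 'cV[R]_n) : R :=
  (x^T *m A *m y) ord0 ord0.

Section BilinearForm.
Variables (R : realType) (n : nat).
Implicit Types (A B : 'M[R]_n) (x y z : 'cV[R]_n).

Lemma bformDl A x y z : bform A (x + y) z = bform A x z + bform A y z.
Proof. by rewrite /bform linearD /= !mulmxDl mxE. Qed.

Lemma bformDr A x y z : bform A x (y + z) = bform A x y + bform A x z.
Proof. by rewrite /bform mulmxDr mxE. Qed.

Lemma bformZl A a x y : bform A (a *: x) y = a * bform A x y.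
Proof. by rewrite /bform linearZ /= -!scalemxAl mxE. Qed.

Lemma bformZr A a x y : bform A x (a *: y) = a * bform A x y.
Proof. by rewrite /bform -scalemxAr mxE. Qed.

Lemma bformNl A x y : bform A (- x) y = - bform A x y.
Proof. by rewrite -scaleN1r bformZl mulN1r. Qed.

Lemma bformNr A x y : bform A x (- y) = - bform A x y.
Proof. by rewrite -scaleN1r bformZr mulN1r. Qed.

Lemma bformDm A B x y : bform (A + B) x y = bform A x y + bform B x y.
Proof. by rewrite /bform mulmxDr mulmxDl mxE. Qed.

Lemma bformNm A x y : bform (- A) x y = - bform A x y.
Proof. by rewrite /bform mulmxN mulNmx mxE. Qed.

Lemma bform_scalar a x y : bform a%:M x y = a * bform 1%:M x y.
Proof. by rewrite /bform mulmx1 mul_mx_scalar -scalemxAl mxE. Qed.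

Lemma bformC A x y : A \is symmetricmx -> bform A x y = bform A y x.
Proof.
(* [symmetricmx] is the hermitian predicate with trivial sign and identity conjugation, so it
   unfolds to [A = A^T]; a 1 x 1 product has the same entry as its transpose. *)
move=> /is_hermitianmxP; rewrite expr0 scale1r map_mx_id // => AT.
by rewrite /bform {1}AT -[in LHS](trmxK y) -!trmx_mul mxE mulmxA.
Qed.

(** In coordinates the form is a polynomial. The shift [y] makes the statement cover the objective
    of a projection; [y = 0] gives the Rayleigh quotient. *)
Lemma continuous_bform A y : continuous (fun x => bform A (x - y) (x - y)).
Proof.
have -> : (fun x => bform A (x - y) (x - y)) =
    (fun x => \sum_(j < n) (\sum_(i < n) (x i ord0 - y i ord0) * A i j) *
       (x j ord0 - y j ord0)).
  apply/funext => x; rewrite /bform mxE; apply: eq_bigr => j _.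
  by rewrite !mxE; congr (_ * _); apply: eq_bigr => i _; rewrite !mxE.
have cf i : continuous (fun x : 'cV[R]_n => x i ord0 - y i ord0).
  move=> x; apply: continuousB; first exact: coord_continuous.
  exact: cst_continuous.
apply: (continuous_big add_continuous) => j _ x.
apply: (@continuousM _ _ (fun z => \sum_(i < n) (z i ord0 - y i ord0) * A i j)
  (fun z => z j ord0 - y j ord0)); last exact: cf.
apply: (continuous_big add_continuous) => {x} i _ x.
by apply: (continuousM (cf i x)); exact: cst_continuous.
Qed.

(** Stated for semidefinite forms, because it is applied to [A - m%:M], which is singular when [m]
    is an eigenvalue. *)
Lemma bform_cauchy_schwarz A x y : A \is symmetricmx ->
  (forall z, 0 <= bform A z z) ->
  bform A x y ^+ 2 <= bform A x x * bform A y y.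
Proof.
move=> As Ap.
have qE a b : bform A (a *: x + b *: y) (a *: x + b *: y) =
    a ^+ 2 * bform A x x + 2 * a * b * bform A x y + b ^+ 2 * bform A y y.
  by rewrite !(bformDl, bformDr, bformZl, bformZr) (bformC y x As); ring.
have := Ap y; rewrite le_eqVlt => /orP[/eqP y0|y0].
  rewrite -y0 mulr0; have [->|B0] := eqVneq (bform A x y) 0.
    by rewrite expr0n.
  (* For isotropic [y] the form is affine along [x + b *: y]; if [bform A x y] were nonzero, this
     choice of [b] would give it the value -1. *)
  have := Ap (1 *: x + - ((bform A x x + 1) / (2 * bform A x y)) *: y).
  rewrite qE -y0.
  have -> : 1 ^+ 2 * bform A x x + 2 * 1 *
     - ((bform A x x + 1) / (2 * bform A x y)) * bform A x y +
     (- ((bform A x x + 1) / (2 * bform A x y))) ^+ 2 * 0 = -1 by field.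
  by rewrite ler0N1.
(* A multiple of the component of [x] orthogonal to [y] for the form, scaled to avoid division. *)
have := Ap (bform A y y *: x + - bform A x y *: y); rewrite qE.
have -> : bform A y y ^+ 2 * bform A x x +
    2 * bform A y y * - bform A x y * bform A x y +
    (- bform A x y) ^+ 2 * bform A y y =
    bform A y y * (bform A x x * bform A y y - bform A x y ^+ 2) by ring.
by rewrite pmulr_rge0 // subr_ge0.
Qed.

Lemma bform_le A x y : A \is symmetricmx -> (forall z, 0 <= bform A z z) ->
  bform A x y <= Num.sqrt (bform A x x) * Num.sqrt (bform A y y).
Proof.
move=> As Ap; rewrite -sqrtrM // (le_trans (ler_norm _)) // -sqrtr_sqr.
by rewrite ler_wsqrtr // bform_cauchy_schwarz.
Qed.

Lemma symmetric_scalar a : (a%:M : 'M[R]_n) \is symmetricmx.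
Proof.
by apply/is_hermitianmxP; rewrite expr0 scale1r map_mx_id // tr_scalar_mx.
Qed.

Lemma symmetricE A : (A \is symmetricmx) = (A == A^T).
Proof. by rewrite is_hermitianmxE expr0 scale1r map_mx_id. Qed.

Lemma bform1E x : bform 1%:M x x = \sum_(i < n) x i ord0 ^+ 2.
Proof.
by rewrite /bform mulmx1 mxE; apply: eq_bigr => i _; rewrite mxE expr2.
Qed.

Lemma bform1_ge0 x : 0 <= bform 1%:M x x.
Proof. by rewrite bform1E sumr_ge0 // => i _; exact: sqr_ge0. Qed.

Lemma enorm_ge0 x : 0 <= enorm x.
Proof. exact: sqrtr_ge0. Qed.

Lemma enormE x : enorm x = Num.sqrt (bform 1%:M x x).
Proof. by rewrite bform1E. Qed.

Lemma bform1_le x y : bform 1%:M x y <= enorm x * enorm y.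
Proof.
by rewrite !enormE; apply: bform_le bform1_ge0; exact: symmetric_scalar.
Qed.

Lemma enormN x : enorm (- x) = enorm x.
Proof. by rewrite !enormE bformNl bformNr opprK. Qed.

Lemma enorm0 : enorm (0 : 'cV[R]_n) = 0.
Proof. by rewrite /enorm -bform1E /bform mulmx0 mxE sqrtr0. Qed.

Lemma enorm_sqr x : enorm x ^+ 2 = bform 1%:M x x.
Proof. by rewrite /enorm -bform1E sqr_sqrtr // bform1_ge0. Qed.

Lemma enorm_eq0 x : enorm x = 0 -> x = 0.
Proof.
move=> x0; have := enorm_sqr x; rewrite x0 expr0n bform1E => /esym/eqP.
rewrite psumr_eq0 => [/allP s0|i _]; last exact: sqr_ge0.
apply/matrixP => i j; rewrite ord1 mxE.
by have := s0 i (mem_index_enum i); rewrite sqrf_eq0 => /eqP.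
Qed.

Lemma coord_le_enorm x i : `|x i ord0| <= enorm x.
Proof.
rewrite -sqrtr_sqr ler_wsqrtr // (bigD1 i) //= lerDl sumr_ge0 // => j _.
exact: sqr_ge0.
Qed.

End BilinearForm.

(** * Extreme eigenvalues, Rayleigh bounds and the operator norm *)

Section Eigenvalues.
Variable R : realType.

Lemma bform_tr_mul m n (A : 'M[R]_(m, n)) x :
  bform (A^T *m A) x x = enorm (A *m x) ^+ 2.
Proof. by rewrite enorm_sqr /bform mulmx1 trmx_mul !mulmxA. Qed.

Lemma eigenvalueN n (A : 'M[R]_n) a : eigenvalue (- A) a = eigenvalue A (- a).
Proof.
apply/eigenvalueP/eigenvalueP => -[v vA v0]; exists v => //.
  by rewrite scaleNr -vA mulmxN opprK.
by rewrite mulmxN vA scaleNr opprK.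
Qed.

Lemma rayleigh_min n (A : 'M[R]_n.+1) : A \is symmetricmx ->
  exists2 m, eigenvalue A m & forall x, m * enorm x ^+ 2 <= bform A x x.
Proof.
move=> As.
have cb B : continuous (fun x : 'cV[R]_n.+1 => bform B x x).
  have -> : (fun x : 'cV[R]_n.+1 => bform B x x) =
      (fun x => bform B (x - 0) (x - 0)) by apply/funext => x; rewrite subr0.
  exact: continuous_bform.
have [|||x|c] := @closed_bounded_cV_min R n.+1 (fun x => bform A x x)
    [set x | bform 1%:M x x = 1] 1.
- exists (delta_mx ord0 ord0); rewrite /= bform1E (bigD1 ord0) //= big1.
    by rewrite mxE !eqxx expr1n addr0.
  by move=> i /negbTE i0; rewrite mxE i0 expr0n.
- exact: ((continuous_closedP _).1 (cb 1%:M) _ (@closed_eq R 1)).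
- move=> x /= x1 i; apply: le_trans (coord_le_enorm x i) _.
  by rewrite -(@ler_pXn2r _ 2) ?nnegrE ?enorm_ge0 // enorm_sqr x1 expr1n.
- exact: cb.
move=> c1 cmin; set m := bform A c c in cmin.
have mE x : m * enorm x ^+ 2 <= bform A x x.
  (* Homogeneity of degree two extends the bound from the unit sphere to nonzero vectors; at 0 both
     sides vanish. *)
  have [x0|x0] := eqVneq (enorm x) 0; last first.
    have := cmin ((enorm x)^-1 *: x).
    rewrite /= !(bformZl, bformZr) -enorm_sqr mulrA -expr2 -exprMn mulVf //.
    rewrite expr1n => /(_ erefl); rewrite mulrA -expr2 exprVn mulrC.
    by rewrite ler_pdivlMr // exprn_gt0 // lt0r x0 enorm_ge0.
  by rewrite x0 expr0n mulr0 (enorm_eq0 x0) /bform mulmx0 mxE.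
exists m => //.
have Bs : A - m%:M \is symmetricmx.
  by move: As; rewrite !symmetricE linearB /= tr_scalar_mx => /eqP <-.
have BE x : bform (A - m%:M) x x = bform A x x - m * enorm x ^+ 2.
  by rewrite bformDm bformNm bform_scalar enorm_sqr.
have B0 x : 0 <= bform (A - m%:M) x x by rewrite BE subr_ge0.
(* [eigenvalue] speaks of row eigenvectors, hence the transpose. *)
apply/eigenvalueP; exists c^T; last first.
  apply/eqP => /(congr1 trmx); rewrite trmxK trmx0 => c0.
  by move: c1 => /eqP; rewrite /= c0 /bform mulmx0 mxE eq_sym oner_eq0.
apply/eqP; rewrite -subr_eq0 -mul_mx_scalar -mulmxBr; apply/eqP/rowP => j.
(* Since [c] is isotropic for [A - m%:M], Cauchy-Schwarz against each basis vector annihilates every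
   coordinate of [c^T *m (A - m%:M)]. *)
have := bform_cauchy_schwarz c (delta_mx j ord0) Bs B0.
rewrite BE enorm_sqr c1 mulr1 subrr mul0r => cj.
have /eqP : bform (A - m%:M) c (delta_mx j ord0) = 0.
  by apply/eqP; rewrite -sqrf_eq0 eq_le cj sqr_ge0.
by rewrite /bform -colE !mxE => /eqP.
Qed.


Lemma eigenvalue_bform n (A : 'M[R]_n) a : eigenvalue A a ->
  exists2 x, 0 < enorm x & bform A x x = a * enorm x ^+ 2.
Proof.
move=> /eigenvalueP[v vA v0]; exists v^T.
  rewrite lt0r enorm_ge0 andbT; apply: contra v0 => /eqP/enorm_eq0 v0.
  by rewrite -(trmxK v) v0 trmx0.
by rewrite enorm_sqr /bform trmxK vA mulmx1 -scalemxAl mxE.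
Qed.

(** Evaluate the bound at an eigenvector. This supplies the lower bound of the spectrum that
    reasoning on the [inf] in [lambda_min] requires. *)
Lemma eigenvalue_ge n (A : 'M[R]_n) m a :
  (forall x, m * enorm x ^+ 2 <= bform A x x) -> eigenvalue A a -> m <= a.
Proof.
move=> mA /eigenvalue_bform[x x0 xE]; have := mA x.
by rewrite xE ler_pM2r // exprn_gt0.
Qed.

Lemma lambda_min_eigenvalue n (A : 'M[R]_n.+1) : A \is symmetricmx ->
  eigenvalue A (lambda_min A).
Proof.
move=> As; have [m Am mA] := rayleigh_min As.
suff -> : lambda_min A = m by [].
apply/eqP; rewrite eq_le ge_inf /=; last first.
- exact: Am.
- by exists m => a /= ; exact: eigenvalue_ge.
by apply: lb_le_inf => [|a]; [exists m | exact: eigenvalue_ge].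
Qed.

Lemma lambda_min_le n (A : 'M[R]_n) x : A \is symmetricmx ->
  lambda_min A * enorm x ^+ 2 <= bform A x x.
Proof.
case: n A x => [|n] A x As.
  by rewrite enorm_sqr /bform mulmx1 (flatmx0 x) !mulmx0 mxE mulr0.
have [m Am mA] := rayleigh_min As.
apply: le_trans (mA x); rewrite ler_wpM2r ?sqr_ge0 //; apply: ge_inf => //.
by exists m => a /=; exact: eigenvalue_ge.
Qed.

(** Negation reflects the spectrum; upper Rayleigh bounds thus follow from lower ones applied to
    [- A]. *)
Lemma lambda_minN n (A : 'M[R]_n) : lambda_min (- A) = - lambda_max A.
Proof.
rewrite /lambda_min /inf; congr (- sup _); apply/seteqP; split=> a /=.
  by move=> [b /=]; rewrite eigenvalueN => ? <-.
by move=> Aa; exists (- a); rewrite ?opprK //= eigenvalueN opprK.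
Qed.

Lemma lambda_max_ge n (A : 'M[R]_n) x : A \is symmetricmx ->
  bform A x x <= lambda_max A * enorm x ^+ 2.
Proof.
move=> As; have NAs : - A \is symmetricmx.
  by move: As; rewrite !symmetricE linearN /= => /eqP <-.
by have := lambda_min_le x NAs; rewrite bformNm lambda_minN mulNr lerN2.
Qed.

Lemma posdef_bform_ge0 n (Q : 'M[R]_n) x : sym_posdef Q -> 0 <= bform Q x x.
Proof.
move=> [_ Qp]; have [->|/Qp/ltW //] := eqVneq x 0.
by rewrite /bform mulmx0 mxE.
Qed.

Lemma lambda_min_gt0 n (Q : 'M[R]_n.+1) : sym_posdef Q -> 0 < lambda_min Q.
Proof.
move=> [Qs Qp].
have [x x0 xE] := eigenvalue_bform (lambda_min_eigenvalue Qs).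
have : 0 < bform Q x x.
  apply: Qp; apply: contraTneq x0 => ->.
  by rewrite enorm0 ltxx.
by rewrite xE pmulr_lgt0 // exprn_gt0.
Qed.

Lemma opnorm_ge m n (A : 'M[R]_(m, n)) x :
  enorm (A *m x) <= opnorm A * enorm x.
Proof.
have AAs : A^T *m A \is symmetricmx.
  by rewrite symmetricE trmx_mul trmxK.
(* [sup] is meaningful only on a bounded set. The upper Rayleigh bound for [A^T *m A] bounds the
   image of the unit ball; afterwards [x] is normalized to lie in that ball. *)
have ub : has_ubound
    [set enorm (A *m x) | x in [set x : 'cV[R]_n | enorm x <= 1]].
  exists (Num.sqrt (lambda_max (A^T *m A))) => _ [y /= y1 <-].
  have := lambda_max_ge y AAs; rewrite bform_tr_mul => /ler_wsqrtr.
  rewrite sqrtr_sqr ger0_norm ?enorm_ge0 // mulrC sqrtrM ?sqr_ge0 //.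
  rewrite sqrtr_sqr ger0_norm ?enorm_ge0 // => /le_trans; apply.
  by rewrite ler_piMl ?sqrtr_ge0.
have [x0|x0] := eqVneq (enorm x) 0.
  by rewrite (enorm_eq0 x0) mulmx0 !enorm0 mulr0.
have xp : 0 < enorm x by rewrite lt0r x0 enorm_ge0.
have enormZ k p (y : 'cV[R]_p) : 0 <= k -> enorm (k *: y) = k * enorm y.
  move=> k0; apply/eqP; rewrite -(@eqrXn2 _ 2) ?mulr_ge0 ?enorm_ge0 //.
  by rewrite exprMn !enorm_sqr bformZl bformZr mulrA expr2.
have V0 : 0 <= (enorm x)^-1 by rewrite invr_ge0 enorm_ge0.
rewrite -ler_pdivrMr // mulrC -enormZ // scalemxAr.
apply: (ub_le_sup ub); exists ((enorm x)^-1 *: x) => //=.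
by rewrite enormZ // mulVf.
Qed.

End Eigenvalues.

(** * Existence of projections and the variational inequality *)

Section Projection.
Variables (R : realType) (n : nat) (S : set 'cV[R]_n.+1).
Hypotheses (S0 : S !=set0) (Scl : closed S) (Scv : convex_set S).

Lemma metric_proj_argmin (Q : 'M[R]_n.+1) y : sym_posdef Q ->
  is_argmin S (fun z => bform Q (z - y) (z - y)) (metric_proj S Q y).
Proof.
move=> Qpd.
have lam0 := lambda_min_gt0 Qpd.
pose f z := bform Q (z - y) (z - y).
have qE z : qnorm Q (z - y) ^+ 2 = f z.
  by rewrite sqr_sqrtr // posdef_bform_ge0.
(* Squaring and the factor 1/2 preserve minimizers, so once [f] has one on [S], [xget] returns a
   genuine minimizer. *)
suff [p Sp pmin] : exists2 p, S p & forall z, S z -> f p <= f z.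
  have [] : is_argmin S (fun z => 2^-1 * qnorm Q (z - y) ^+ 2)
      (metric_proj S Q y).
    apply: xgetPex; exists p; split=> // z Sz.
    by rewrite !qE ler_pM2l ?invr_gt0 // pmin.
  move=> Sq qmin; split=> // z /qmin.
  by rewrite !qE ler_pM2l ?invr_gt0.
have [s Ss] := S0.
have fcont : continuous f by exact: continuous_bform.
(* Cutting [S] by the sublevel set of a point [s] makes it bounded: there
   [lambda_min Q * enorm (z - y) ^+ 2 <= f s], with [lambda_min Q] positive. *)
have [|||//|p [Sp ps] pmin] := @closed_bounded_cV_min R n.+1 f
    (S `&` [set z | f z <= f s]) (Num.sqrt (f s / lambda_min Q) + enorm y).
- by exists s; split=> /=.
- apply: closedI => //.
  exact: ((continuous_closedP _).1 fcont _ (@closed_le R (f s))).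
- move=> z [_ /= zs] i.
  have -> : z i ord0 = (z - y) i ord0 + y i ord0 by rewrite !mxE subrK.
  apply: le_trans (ler_normD _ _) _; apply: lerD; last exact: coord_le_enorm.
  apply: le_trans (coord_le_enorm _ _) _.
  rewrite -[leLHS]ger0_norm ?enorm_ge0 // -sqrtr_sqr ler_wsqrtr //.
  rewrite ler_pdivlMr // mulrC; apply: le_trans zs.
  by apply: lambda_min_le; case: Qpd.
exists p => // z Sz; have [zs|/ltW zs] := leP (f z) (f s).
  exact: pmin.
exact: le_trans ps zs.
Qed.

Lemma metric_proj_in (Q : 'M[R]_n.+1) y : sym_posdef Q ->
  S (metric_proj S Q y).
Proof. by case/(metric_proj_argmin y). Qed.

(** First-order optimality: moving from the projection [p] a fraction [t] of the way to [z] stays in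
    [S] and cannot decrease the objective. Expanding and dividing by [t] gives
    [0 <= 2 * b + t * q]. *)
Lemma metric_proj_variational (Q : 'M[R]_n.+1) y z : sym_posdef Q -> S z ->
  0 <= bform Q (metric_proj S Q y - y) (z - metric_proj S Q y).
Proof.
move=> Qpd Sz; have Qs := Qpd.1.
have [] := metric_proj_argmin y Qpd.
set p := metric_proj S Q y => Sp pmin.
set b := bform Q (p - y) (z - p); set q := bform Q (z - p) (z - p).
have q0 : 0 <= q by exact: posdef_bform_ge0.
have line t : 0 < t -> t <= 1 -> 0 <= 2 * b + t * q.
  move=> t0 t1.
  have Spt : S (p + t *: (z - p)).
    have /set_mem := Scv (Itv01 (ltW t0) t1) (mem_set Sz) (mem_set Sp).
    by congr S; rewrite /conv /= scalerBr scalerBl scale1r addrCA.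
  have := pmin _ Spt.
  have -> : p + t *: (z - p) - y = (p - y) + t *: (z - p) by rewrite addrAC.
  move: (p - y) (z - p) @b @q q0 {Spt} => u v b q q0.
  rewrite !(bformDl, bformDr, bformZl, bformZr) (bformC v u Qs) -/b -/q.
  rewrite -subr_ge0.
  have -> : bform Q u u + t * b + (t * b + t * (t * q)) - bform Q u u =
    t * (2 * b + t * q) by ring.
  by rewrite pmulr_rge0.
rewrite leNgt; apply/negP => b0.
(* If [b < 0], this [t] lies in (0, 1] and gives [t * q <= - b], so [2 * b + t * q <= b < 0]. The
   denominator is positive even when [q = 0]. *)
have tp : 0 < - b / (q - b) by rewrite divr_gt0 //; lra.
have := line _ tp; rewrite ler_pdivrMr; last by lra.
have : - b / (q - b) * q <= - b.
  by rewrite mulrAC ler_pdivrMr; nra.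
lra.
Qed.

End Projection.

(** * Quadratic inequality and the final estimate *)

(** Here [D] stands for the [Q1]-norm of the difference of the projections, [d] for its Euclidean
    norm and [s] for the square root of [lambda_min Q1]. For [D > 0], replacing [s * d] by [D] and
    cancelling [D] gives [s * D <= s * W + E]; then [s * d <= D] is used once more. *)
Lemma le_div_of_quadratic (R : realFieldType) (D s W E d : R) :
  0 < s -> 0 <= W -> 0 <= E -> s * d <= D -> 0 <= D ->
  D ^+ 2 <= W * D + E * d -> d <= W / s + E / s ^+ 2.
Proof.
move=> s0 W0 E0 sdD D0 quad.
have -> : W / s + E / s ^+ 2 = (s * W + E) / s ^+ 2 by field; rewrite gt_eqF.
rewrite ler_pdivlMr ?exprn_gt0 //.
have [D1|D1] := eqVneq D 0.
  have : d <= 0 by rewrite -(pmulr_rle0 _ s0) -D1.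
  have : 0 < s ^+ 2 by rewrite exprn_gt0.
  have : 0 <= s * W by rewrite mulr_ge0 // ltW.
  nra.
have Dp : 0 < D by rewrite lt0r D1.
have : s * D <= s * W + E.
  rewrite -(ler_pM2r Dp).
  have : s * D ^+ 2 <= s * (W * D + E * d) by rewrite ler_pM2l.
  have : E * (s * d) <= E * D by rewrite ler_wpM2l.
  lra.
have : s * (s * d) <= s * D by rewrite ler_pM2l.
lra.
Qed.

Unset Implicit Arguments.

Theorem proposition4 (R : realType) (n : nat) (S : set 'cV[R]_n)
    (Q1 Q2 : 'M[R]_n) (S_nonempty : S !=set0) (S_closed : closed S)
    (S_convex : convex_set S) (Q1_spd : sym_posdef Q1) (Q2_spd : sym_posdef Q2)
    (z1 z2 : 'cV[R]_n) :
  enorm (metric_proj S Q1 z1 - metric_proj S Q2 z2) <=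
    Num.sqrt (lambda_max Q1 / lambda_min Q1) * enorm (z1 - z2) +
    opnorm (Q1 - Q2) / lambda_min Q1 * enorm (metric_proj S Q2 z2 - z2).
Proof.
(* In dimension 0 [lambda_min Q1] is 0, but all vector norms vanish and so do both sides. *)
have [n0|n0] := posnP n.
  subst n; have e0 (x : 'cV[R]_0) : enorm x = 0 by rewrite (flatmx0 x) enorm0.
  by rewrite !e0 !mulr0 addr0.
case: n n0 S Q1 Q2 S_nonempty S_closed S_convex Q1_spd Q2_spd z1 z2 => // n _.
move=> S Q1 Q2 S0 Scl Scv Q1pd Q2pd z1 z2.
have lam0 := lambda_min_gt0 Q1pd.
have Q1s := Q1pd.1.
have Sp1 := metric_proj_in S0 Scl z1 Q1pd.
have Sp2 := metric_proj_in S0 Scl z2 Q2pd.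
(* Each variational inequality is tested at the other projection. *)
have := metric_proj_variational S0 Scl Scv z1 Q1pd Sp2.
have := metric_proj_variational S0 Scl Scv z2 Q2pd Sp1.
set p1 := metric_proj S Q1 z1; set p2 := metric_proj S Q2 z2.
set d := p1 - p2; set e := p2 - z2; set w := z1 - z2.
have -> : p2 - p1 = - d by rewrite opprB.
have -> : p1 - z1 = d + e - w by rewrite /d /e /w subrKA opprB addrA subrK.
rewrite bformNr (bformDl _ (d + e)) (bformDl _ d) bformNl => V2 V1.
set mn := lambda_min Q1 in lam0 *; set mx := lambda_max Q1.
have d0 := enorm_ge0 d.
have mnd : mn * enorm d ^+ 2 <= bform Q1 d d by exact: lambda_min_le.
have wmx : bform Q1 w w <= mx * enorm w ^+ 2 by exact: lambda_max_ge.
have wd : bform Q1 w d <= Num.sqrt mx * enorm w * Num.sqrt (bform Q1 d d).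
  apply: le_trans (bform_le _ _ Q1s (fun z => posdef_bform_ge0 z Q1pd)) _.
  rewrite ler_wpM2r ?sqrtr_ge0 // (le_trans (ler_wsqrtr wmx)) //.
  by rewrite mulrC sqrtrM ?sqr_ge0 // sqrtr_sqr ger0_norm ?enorm_ge0 // mulrC.
(* The mismatch of the two metrics is the Euclidean product of [- e] and [(Q1 - Q2) *m d]. *)
have opA : - bform Q1 e d + bform Q2 e d <=
    opnorm (Q1 - Q2) * enorm e * enorm d.
  have -> : - bform Q1 e d + bform Q2 e d = bform 1%:M (- e) ((Q1 - Q2) *m d).
    rewrite bformNl addrC -[LHS]opprB -(bformNm Q2) -bformDm.
    by rewrite /bform mulmx1 mulmxA.
  rewrite mulrAC [leRHS]mulrC.
  apply: le_trans (bform1_le _ _) _; rewrite enormN.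
  by rewrite ler_wpM2l ?enorm_ge0 // opnorm_ge.
have E0 : 0 <= opnorm (Q1 - Q2) * enorm e.
  exact: le_trans (enorm_ge0 _) (opnorm_ge _ _).
have -> : Num.sqrt (mx / mn) * enorm w = Num.sqrt mx * enorm w / Num.sqrt mn.
  by rewrite mulrC [mx / mn]mulrC sqrtrM ?invr_ge0 ?ltW // sqrtrV ?ltW //; ring.
have sE : Num.sqrt mn ^+ 2 = mn by rewrite sqr_sqrtr // ltW.
have D2E : Num.sqrt (bform Q1 d d) ^+ 2 = bform Q1 d d.
  by rewrite sqr_sqrtr // posdef_bform_ge0.
rewrite [X in _ + X]mulrAC -[X in _ + _ / X]sE.
apply: (@le_div_of_quadratic _ (Num.sqrt (bform Q1 d d))) => //.
- by rewrite sqrtr_gt0.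
- by rewrite mulr_ge0 ?sqrtr_ge0 ?enorm_ge0.
- by rewrite -(@ler_pXn2r _ 2) ?nnegrE ?mulr_ge0 ?sqrtr_ge0 // exprMn sE D2E.
(* The sum of [V1] and [V2], with [wd] and [opA] bounding its cross terms. *)
- by rewrite D2E; lra.
Qed.
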